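(* Let $G$ be a cubic graph. Then $|V(G)|=t(G)+\ell(G)$.
   Context: Graphs are finite and loopless but may have parallel edges (and may have bridges). A cubic graph is one in which every vertex has degree $3$. For a cubic graph $G$ and $U\subseteq V(G)$, $G_U$ denotes the cubic graph obtained from $G$ by expanding every vertex of $U$ into a triangle: a vertex $v$ with incident edges $e_1,e_2,e_3$ is replaced by three new mutually adjacent vertices $v_1,v_2,v_3$, with $e_i$ now incident to $v_i$ instead of $v$. $t(G)$ is the minimum size of a set $U\subseteq V(G)$ such that $G_U$ has a perfect matching. $\ell(G)$ is the maximum number of edges of a subgraph of $G$ in which every vertex has even degree (a largest even subgraph / longest cycle, where a cycle is a union of vertex-disjoint circuits). *)

(* Defs.v *)
From mathcomp Require Import all_boot.

Set Implicit Arguments.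
Unset Strict Implicit.
Unset Printing Implicit Defensive.

(* Edges form a separate type, so distinct edges may have the same ends;
   [ends_card] excludes loops. *)
Record multigraph := Multigraph {
  vertex : finType;
  edge : finType;
  ends : edge -> {set vertex};
  ends_card : forall e, #|ends e| = 2
}.

Section Graph.
Variable G : multigraph.

Definition incident (v : vertex G) : {set edge G} := [set e | v \in ends e].

Definition cubic := forall v : vertex G, #|incident v| = 3.

Definition perfect_matching (M : {set edge G}) :=
  [forall v, #|incident v :&: M| == 1].

Definition has_perfect_matching := [exists M, perfect_matching M].

(* A pair (W, F) stands for the graph with vertex set W and edge set F. *)
Definition subgraph (H : {set vertex G} * {set edge G}) :=
  [forall e in H.2, ends e \subset H.1].

Definition even_subgraph (H : {set vertex G} * {set edge G}) :=
  subgraph H && [forall v in H.1, ~~ odd #|incident v :&: H.2|].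

Definition ell := \max_(H | even_subgraph H) #|H.2|.

End Graph.

Section Expand.
Variables (G : multigraph) (U : {set vertex G}).

(* A vertex v of U is replaced by the vertices (v, e), one for each edge e
   incident to v. *)
Definition expand_vertex_pred (x : vertex G + vertex G * edge G) :=
  match x with
  | inl v => v \notin U
  | inr (v, e) => (v \in U) && (v \in ends e)
  end.

Definition expand_vertex := {x | expand_vertex_pred x}.

(* The new edges at v are (v, A), for A a two-element set of edges incident to
   v: the edge (v, {e, f}) joins (v, e) to (v, f). *)
Definition expand_edge_pred (x : edge G + vertex G * {set edge G}) :=
  match x with
  | inl e => true
  | inr (v, A) => [&& v \in U, A \subset incident v & #|A| == 2]
  end.

Definition expand_edge := {x | expand_edge_pred x}.

Definition expand_incidence (x : vertex G + vertex G * edge G)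
    (y : edge G + vertex G * {set edge G}) :=
  match x, y with
  | inl v, inl e => v \in ends e
  | inr (v, f), inl e => f == e
  | inl _, inr _ => false
  | inr (v, f), inr (w, A) => (v == w) && (f \in A)
  end.

Definition expand_ends (y : expand_edge) : {set expand_vertex} :=
  [set x | expand_incidence (val x) (val y)].

Lemma expand_ends_card y : #|expand_ends y| = 2.
Proof.
rewrite -(card_imset _ val_inj) /=.
case: y => [[e|[v A]] /= Py].
- have inj : injective (fun v : vertex G =>
      if v \in U then inr (v, e) else inl v : vertex G + vertex G * edge G).
    by move=> v w; case: (v \in U); case: (w \in U) => // -[].
  rewrite -(ends_card e) -(card_imset _ inj); apply: eq_card => x.
  apply/imsetP/imsetP => [[[z Pz]] | [v ve ->]].
    rewrite inE /= => zi ->; case: z Pz zi => [v|[v f]] /=.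
      by move=> /negPf vU ve; exists v; rewrite ?vU.
    by move=> /andP[vU vf] /eqP <-; exists v; rewrite ?vU.
  have P : expand_vertex_pred (if v \in U then inr (v, e) else inl v).
    by case: ifP => /= vU; rewrite vU ?ve.
  by exists (Sub _ P) => //; rewrite inE /=; case: ifP => /=.
- case/and3P: (Py) => vU /subsetP sA /eqP cA.
  have inj : injective (fun e : edge G =>
      inr (v, e) : vertex G + vertex G * edge G) by move=> e f [].
  rewrite -cA -(card_imset _ inj); apply: eq_card => x.
  apply/imsetP/imsetP => [[[z Pz]] | [f fA ->]].
    rewrite inE /= => zi ->; case: z Pz zi => [w|[w f]] //=.
    by move=> _ /andP[/eqP-> fA]; exists f.
  have P : expand_vertex_pred (inr (v, f)).
    by rewrite /= vU; have := sA _ fA; rewrite inE.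
  by exists (Sub _ P) => //; rewrite inE /= eqxx.
Qed.

Definition expand : multigraph :=
  @Multigraph expand_vertex expand_edge expand_ends expand_ends_card.

End Expand.

Lemma expand_cubic (G : multigraph) (U : {set vertex G}) :
  cubic G -> cubic (expand U).
Proof.
move=> G3 [[v|[v e]] Px]; rewrite -(card_imset _ val_inj) /=.
- have inj : injective (inl : edge G -> edge G + vertex G * {set edge G}).
    by move=> e f [].
  rewrite -(G3 v) -(card_imset _ inj); apply: eq_card => y.
  apply/imsetP/imsetP => [[[[e|[w A]] Pz]] | [e]].
  + by rewrite !inE /= => ve ->; exists e; rewrite ?inE.
  + by rewrite !inE.
  + by rewrite inE => ve ->; exists (Sub (inl e) isT : expand_edge U); rewrite ?inE.
- case/andP: (Px) => vU ve.
  pose g (f : edge G) : edge G + vertex G * {set edge G} :=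
    if f == e then inl e else inr (v, [set e; f]).
  have inj : injective g.
    move=> f h; rewrite /g; case: eqP => [->|/eqP fe]; case: eqP => [->|/eqP he] //.
    move=> [] /setP/(_ f); rewrite !inE (negPf fe) eqxx /=.
    by move/esym/eqP.
  rewrite -(G3 v) -(card_imset _ inj); apply: eq_card => y.
  apply/imsetP/imsetP => [[[[f|[w A]] Pz]] | [f]].
  + rewrite !inE /= => /eqP <- ->; exists e; first by rewrite inE.
    by rewrite /g eqxx.
  + rewrite !inE /= => /andP[/eqP wv eA] ->.
    rewrite -{w}wv in Pz *; case/and3P: (Pz) => _ /subsetP sA /eqP.
    rewrite (cardsD1 e) eA => -[] /eqP/cards1P[f Af].
    have := set11 f; rewrite -Af !inE => /andP[fe fA].
    exists f; first exact: sA.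
    by rewrite /g (negPf fe) -Af setD1K.
  + rewrite inE => vf ->; have P : expand_edge_pred U (g f).
      rewrite /g; case: eqP => //= /eqP fe; rewrite vU cards2 (eq_sym e) fe andbT.
      by apply/subsetP => h; rewrite !inE => /orP[]/eqP->.
    exists (Sub (g f) P : expand_edge U) => //; rewrite !inE /= /g.
    by case: eqP; rewrite /= eqxx ?set21.
Qed.

Lemma expand_setT_perfect_matching (G : multigraph) :
  has_perfect_matching (expand [set: vertex G]).
Proof.
apply/existsP; exists [set y : expand_edge setT |
  if val y is inl _ then true else false].
apply/forallP => -[[v|[v e]] /= Px]; first by have := Px; rewrite /= inE.
apply/cards1P; exists (Sub (inl e) isT : expand_edge setT).
apply/setP => y; rewrite !inE -val_eqE /=.
by case: y => [[f|[w A]] /= _]; rewrite ?andbT ?andbF // eq_sym.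
Qed.

(* [setT] is an admissible set by the previous lemma, so this is a minimum. *)
Definition t (G : multigraph) :=
  #|[arg min_(U < [set: vertex G] | has_perfect_matching (expand U)) #|U|]|.

(* Main.v *)
Require Import Defs.
From mathcomp Require Import all_boot zify.

(** In a cubic graph an even subgraph has degree 0 or 2 at every vertex, so it
    has as many edges as vertices of degree 2.  If [F] is even, its complement
    is a perfect matching once the vertices of degree 0 in [F] are expanded.
    Conversely, let [M] be a perfect matching of [expand U].  At an expanded
    vertex the triangle edges of [M] cover an even number of the three corners,
    so the edges of [G] outside [M] form an even subgraph, of degree 2 at every
    vertex outside [U]. *)

Set Implicit Arguments.
Unset Strict Implicit.
Unset Printing Implicit Defensive.

Lemma card_sum_mem (T : finType) (A B : {set T}) :
  #|A :&: B| = \sum_(x in A) (x \in B).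
Proof.
rewrite -sum1_card big_mkcond [RHS]big_mkcond; apply: eq_bigr => x _.
by rewrite inE; case: (x \in A); case: (x \in B).
Qed.

Section EvenEdgeSets.
Variable G : multigraph.
Implicit Types (F : {set edge G}) (v : vertex G).

Definition even_edges F := [forall v, ~~ odd #|incident v :&: F|].

Definition covered F := [set v | incident v :&: F != set0].

(** Double counting: each edge has exactly two ends. *)
Lemma handshake F : \sum_v #|incident v :&: F| = 2 * #|F|.
Proof.
under eq_bigr => v _ do rewrite setIC card_sum_mem.
rewrite exchange_big /= mulnC -sum_nat_const; apply: eq_bigr => e _.
rewrite -(ends_card e) -sum1_card [RHS]big_mkcond; apply: eq_bigr => v _.
by rewrite inE; case: (_ \in _).
Qed.

(** A vertex outside [H.1] meets no edge of [H.2], so only the edge part of an even subgraph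
    matters. *)
Lemma even_subgraph_edges H : even_subgraph H -> even_edges H.2.
Proof.
move=> /andP[/forall_inP sub /forall_inP ev]; apply/forallP => v.
have [/ev//|vH] := boolP (v \in H.1).
suff -> : incident v :&: H.2 = set0 by rewrite cards0.
apply/setP => e; rewrite !inE; apply/negP => /andP[ve /sub/subsetP/(_ v ve)].
exact/negP.
Qed.

Lemma even_edges_subgraph F : even_edges F -> even_subgraph ([set: vertex G], F).
Proof.
move=> /forallP ev; apply/andP; split; last exact/forall_inP.
by apply/forall_inP => e _; apply/subsetP => v _; rewrite inE.
Qed.

Hypothesis G3 : cubic G.

Lemma cubic_degree_compl F v :
  #|incident v :&: F| + #|incident v :&: ~: F| = 3.
Proof. by rewrite -setDE cardsID G3. Qed.

Lemma even_edges_degree F v :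
  even_edges F -> #|incident v :&: F| = 2 * (v \in covered F).
Proof.
move=> /forallP/(_ v); have := cubic_degree_compl F v.
rewrite inE -cards_eq0; case: #|incident v :&: F| => [|[|[|[|n]]]] //; lia.
Qed.

Lemma card_even_edges F : even_edges F -> #|F| = #|covered F|.
Proof.
move=> ev; apply/eqP; rewrite -(eqn_pmul2l (isT : 0 < 2)) -handshake.
under eq_bigr => v _ do rewrite even_edges_degree //.
rewrite -big_distrr /= -sum1_card [X in _ == 2 * X]big_mkcond.
by apply/eqP; congr (2 * _); apply: eq_bigr => v _; case: (_ \in _).
Qed.

(** The matching consists of the original edges outside [F], without triangle edges. A covered
    vertex meets 3 - 2 = 1 of them; a corner [(v, e)] meets only [e], which is outside [F] because
    [v] is uncovered. *)
Lemma even_edges_matching F :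
  even_edges F -> has_perfect_matching (expand (~: covered F)).
Proof.
move=> ev; apply/existsP.
exists [set y : expand_edge _ | if val y is inl e then e \notin F else false].
apply/forallP => -[[v|[v e]] Px] /=; rewrite -(card_imset _ val_inj) /=.
- have inj : injective (inl : edge G -> edge G + vertex G * {set edge G}).
    by move=> ? ? [].
  have vF : v \in covered F by move: Px; rewrite /= in_setC negbK.
  have := cubic_degree_compl F v; rewrite even_edges_degree // vF => -[<-].
  rewrite -(card_imset _ inj); apply/eqP/eq_card => y.
  apply/imsetP/imsetP => [[[[f|[w A]] Py]] | [f]].
  + by rewrite !inE /= => vf ->; exists f; rewrite ?inE.
  + by rewrite !inE.
  + move=> fF ->; exists (Sub (inl f) isT : expand_edge _) => //.
    by move: fF; rewrite !inE.
- have /andP[vU ve] : (v \in ~: covered F) && (v \in ends e) by exact: Px.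
  have eF : e \notin F.
    move: vU; rewrite !inE negbK => /eqP/setP/(_ e).
    by rewrite !inE ve /= => ->.
  apply/cards1P; exists (inl e); apply/setP => y; rewrite inE.
  apply/imsetP/eqP => [[[[f|[w A]] Py]] | ->].
  + by rewrite !inE /= => /andP[/eqP<- _].
  + by rewrite !inE andbF.
  + by exists (Sub (inl e) isT : expand_edge _); rewrite // !inE /= eqxx.
Qed.

End EvenEdgeSets.

Section MatchingOfExpansion.
Variables (G : multigraph) (U : {set vertex G}).
Variable M : {set edge (expand U)}.
Hypotheses (G3 : cubic G) (PM : perfect_matching M).

(** The matching is moved to the plain sum type, where membership of [inl e] or [inr (v, A)] needs
    no validity proof. *)
Let M' : {set edge G + vertex G * {set edge G}} := val @: M.

Definition matched_edges : {set edge G} := [set e | inl e \in M'].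

Definition matched_pairs v : {set {set edge G}} := [set A | inr (v, A) \in M'].

Lemma matched_pairsP v A : A \in matched_pairs v ->
  A \subset incident v /\ #|A| = 2.
Proof.
rewrite inE => /imsetP[[y Py] _ /= yE].
by move: Py; rewrite -yE /= => /and3P[_ ? /eqP].
Qed.

Lemma expand_degree1 (x : expand_vertex U) :
  #|[set y in M' | expand_incidence (val x) y]| = 1.
Proof.
rewrite -(eqP (forallP PM x)) -[RHS](card_imset _ val_inj).
apply: eq_card => z; rewrite !inE.
apply/andP/imsetP => [[/imsetP[y yM ->] xy] | [y]].
  by exists y; rewrite // !inE yM andbT.
by rewrite !inE => /andP[xy yM] ->; rewrite imset_f.
Qed.

Lemma matched_degree_notin v : v \notin U ->
  #|incident v :&: matched_edges| = 1.
Proof.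
move=> vU; rewrite -(expand_degree1 (exist _ (inl v) vU)) /=.
have inj : injective (inl : edge G -> edge G + vertex G * {set edge G}).
  by move=> ? ? [].
rewrite -(card_imset _ inj); apply: eq_card => z; rewrite !inE.
apply/imsetP/andP => [[e + ->] | []]; first by rewrite !inE => /andP[].
by case: z => [e|[w A]] //= eM ve; exists e; rewrite // !inE ve.
Qed.

(** The edges at the corner [(v, e)] are [e] and the triangle edges [(v, A)] with [e] in [A];
    exactly one is matched. *)
Lemma matched_corner v e : v \in U -> v \in ends e ->
  (e \in matched_edges) + \sum_(A in matched_pairs v) (e \in A) = 1.
Proof.
move=> vU ve.
have Px : expand_vertex_pred U (inr (v, e)) by rewrite /= vU ve.
rewrite -(expand_degree1 (Sub _ Px)) /= setIdE card_sum_mem.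
rewrite big_sumType /=; congr (_ + _).
  rewrite inE big_mkcond (bigD1 e) //= inE /= eqxx big1 ?addn0.
    by case: ifP.
  by move=> f fe; rewrite inE /= (eq_sym e) (negPf fe) if_same.
rewrite big_mkcond [RHS]big_mkcond /=.
(* The sum over pairs [(w, A)] is split so that only the triangle at [w = v] contributes. *)
pose h w A : nat := if inr (w, A) \in M' then
  expand_incidence (inr (v, e)) (inr (w, A)) : nat else 0.
transitivity (\sum_w \sum_A h w A); last first.
  by rewrite pair_bigA; apply: eq_bigr => -[w A] _; rewrite inE.
rewrite (bigD1 v) //= [X in _ = _ + X]big1 ?addn0.
  by apply: eq_bigr => A _; rewrite /h inE /= eqxx.
move=> w wv; apply: big1 => A _.
by rewrite /h /= (eq_sym v) (negPf wv) if_same.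
Qed.

(** By [matched_corner], an edge at [v] is unmatched exactly when one matched pair contains it, and
    each pair contains two edges at [v]. *)
Lemma unmatched_degree_in v : v \in U ->
  #|incident v :&: ~: matched_edges| = 2 * #|matched_pairs v|.
Proof.
move=> vU; rewrite card_sum_mem.
transitivity (\sum_(e in incident v) \sum_(A in matched_pairs v) (e \in A)).
  apply: eq_bigr => e; rewrite inE => ve; have := matched_corner vU ve.
  by rewrite in_setC; case: (e \in matched_edges) => /=; lia.
rewrite exchange_big /= mulnC -sum_nat_const; apply: eq_bigr => A.
by case/matched_pairsP => sA cA; rewrite -card_sum_mem (setIidPr sA).
Qed.

Lemma even_unmatched : even_edges (~: matched_edges).
Proof.
apply/forallP => v; have [vU|vU] := boolP (v \in U).
  by rewrite unmatched_degree_in // oddM.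
have := cubic_degree_compl G3 matched_edges v.
by rewrite matched_degree_notin // add1n => -[->].
Qed.

Lemma covered_unmatched : ~: U \subset covered (~: matched_edges).
Proof.
apply/subsetP => v; rewrite in_setC inE => vU; rewrite -cards_eq0.
have := cubic_degree_compl G3 matched_edges v.
by rewrite matched_degree_notin // add1n => -[->].
Qed.

End MatchingOfExpansion.

Theorem theorem4p1 (G : multigraph) (hG : cubic G) :
  #|vertex G| = t G + ell G.
Proof.
rewrite /t; case: arg_minnP => [|U /existsP[M PM] Umin].
  exact: expand_setT_perfect_matching.
have ev := even_unmatched hG PM.
apply/eqP; rewrite eqn_leq; apply/andP; split.
  (* The unmatched edges form an even subgraph with at least as many edges as there are vertices
     outside [U]. *)
  rewrite -(cardsC U) leq_add2l.
  apply: leq_trans (subset_leq_card (covered_unmatched hG PM)) _.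
  rewrite -card_even_edges //.
  exact: (leq_bigmax_cond (_, _) (even_edges_subgraph ev)).
(* Isolating [ell G] reduces the bound to each even subgraph [H]; minimality of [U] is then applied
   to the vertices that [H.2] leaves uncovered. *)
apply: (@leq_trans (#|U| + (#|vertex G| - #|U|))); last first.
  by rewrite subnKC // max_card.
rewrite leq_add2l; apply/bigmax_leqP => H /even_subgraph_edges evH.
rewrite (card_even_edges hG evH) -(cardsC (covered H.2)) leq_subRL.
  by rewrite addnC leq_add2l (Umin _ (even_edges_matching hG evH)).
by rewrite cardsC max_card.
Qed.
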